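(* Let $q$ be an odd prime power and let $f = a\mathtt{x} + b\mathtt{x}^q + \mathtt{x}^{2q-1} \in \mathbb{F}_q[\mathtt{x}]$ (so $a,b\in\mathbb{F}_q$). Then $f$ is a permutation polynomial of $\mathbb{F}_{q^2}$ if and only if one of the following is satisfied: (i) $a(a-1)$ is a square in $\mathbb{F}_q^*$, and $b^2 = a^2 + 3a$; (ii) $a = 1$, and $b^2 - 4$ is a square in $\mathbb{F}_q^*$; (iii) $a = 3$, $b = 0$, and $q \equiv -1 \pmod 6$; (iv) $a = b = 0$, and $q \equiv 1$ or $3 \pmod 6$.
   Context: $\mathbb{F}_q$ is the finite field with $q$ elements and $\mathbb{F}_q^* = \mathbb{F}_q\setminus\{0\}$. A polynomial $f$ with coefficients in a finite field $F$ is called a permutation polynomial of $F$ if the map $F\to F$, $x\mapsto f(x)$, is a bijection; here $f\in\mathbb{F}_q[\mathtt{x}]$ is viewed as a polynomial over $\mathbb{F}_{q^2}$. ''$u$ is a square in $\mathbb{F}_q^*$'' means that $u = v^2$ for some $v\in\mathbb{F}_q^*$ (in particular $u\neq 0$). Integers appearing as elements of $\mathbb{F}_q$ are read modulo the characteristic. *)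

(* Defs.v *)
From HB Require Import structures.
From mathcomp Require Import all_boot all_order all_algebra all_field.

Set Implicit Arguments.
Unset Strict Implicit.
Unset Printing Implicit Defensive.

Import GRing.Theory.
Local Open Scope ring_scope.

Definition permutation_poly (L : finFieldType) (g : {poly L}) : Prop :=
  bijective (fun x : L => g.[x]).

Definition nonzero_square (F : fieldType) (u : F) : Prop :=
  exists v : F, v != 0 /\ u = v ^+ 2.

Definition trinomial (F : fieldType) (q : nat) (a b : F) : {poly F} :=
  a *: 'X + b *: 'X^q + 'X^(2 * q - 1)%N.

(* Main.v *)
Require Import Defs.
From HB Require Import structures.
From mathcomp Require Import all_boot all_order all_algebra all_field.
From mathcomp Require Import cyclic ring zify.

(** For u of norm one over F_q (u^(q + 1) = 1) put h(u) = u^2 + b u + a. The trinomial is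
    f(x) = x h(x^(q - 1)), so it permutes F_(q^2) if and only if h has no zero of norm
    one and g(u) = u h(u)^(q - 1) permutes the q + 1 elements of norm one
    (unitary_perm_bijective). On these elements
      g(u) = (a u^2 + b u + 1) / (u^3 + b u^2 + a u),
    and the fibre of g over c is the set of roots of a cubic (fibre a b c). Its
    discriminant disc a b c is a palindromic quartic in c.

    The involution x |-> x^(- q) permutes the roots of the cubic over each c of norm one,
    and its fixed points are the roots of norm one. Comparing with the conjugation
    of the product of the differences of the roots, one finds that disc / c^2 is a
    nonzero square of F_q if exactly one of three distinct roots has norm one
    (disc_one_unitary_root), and is not one if all three have (unitary_fibre_inj).

    If g is a permutation, disc / c^2 is therefore a square of F_q for every c of norm
    one, its zeros coming from triple roots. One expects this to force the
    quartic to be a constant times a square, by the Hasse bound for the curve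
    y^2 = disc; quartic_square_values proves it with an explicit polynomial identity that
    captures the only instance of the bound involved. The equations on the
    coefficients of disc then factor (disc_coef_discr) and give the four families;
    the remaining square conditions express that the constant has the right
    quadratic character (unitary_perm_coefs). Conversely, disc / c^2 is an
    explicit square in the families b^2 = a^2 + 3 a, a = 3 and a = 0, and it vanishes only
    over perfect cubes, so that g is injective; for a = 1 the fraction g simplifies
    to 1 / u (coefs_unitary_perm). *)

Set Implicit Arguments.
Unset Strict Implicit.
Unset Printing Implicit Defensive.

Import GRing.Theory.
Local Open Scope ring_scope.

(** * Frobenius and the unit group of a finite field *)

Lemma pnat_sqrt_card (L : finFieldType) (q : nat) :
  #|L| = (q ^ 2)%N -> [pchar L].-nat q.
Proof.
move=> card_L; have [p p_pr pcharLp] := finPcharP L.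
rewrite (eq_pnat _ (pcharf_eq pcharLp)).
have: p.-nat #|L| by rewrite (card_pprimeChar pcharLp) pnatX pnat_id.
by rewrite card_L pnatX orbF.
Qed.

Lemma Frobenius_rmorphism (L : comNzRingType) (q : nat) :
  [pchar L].-nat q -> {f : {rmorphism L -> L} | forall x, f x = x ^+ q}.
Proof.
move=> pq; pose f (x : L) := x ^+ q.
have fB : zmod_morphism f.
  by move=> x y; rewrite /f exprDn_pchar // exprNn_pchar.
have fM : monoid_morphism f by split=> [|x y]; rewrite /f ?expr1n ?exprMn.
pose m1 := GRing.isZmodMorphism.Build L L f fB.
pose m2 := GRing.isMonoidMorphism.Build L L f fM.
pose fr : {rmorphism L -> L} := HB.pack f m1 m2.
by exists fr.
Qed.

Lemma finField_prim_root (L : finFieldType) :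
  {g : L | #|L|.-1.-primitive_root g}.
Proof.
apply/sigW.
have L1 : (0 < #|L|.-1)%N by rewrite -ltnS prednK ?finNzRing_gt1 // ltnW ?finNzRing_gt1.
have /hasP[g _ gP] : has #|L|.-1.-primitive_root (rem 0 (enum L)); last by exists g.
apply: has_prim_root => //; last 1 first.
- by rewrite size_rem ?mem_enum // -cardE.
- apply/allP=> x; rewrite mem_rem_uniq ?enum_uniq // inE => /andP[x0 _].
  rewrite unity_rootE; apply/eqP/(mulfI x0).
  by rewrite mulr1 -exprS prednK ?expf_card // ltnW ?finNzRing_gt1.
- by rewrite rem_uniq ?enum_uniq.
Qed.

(** In a cyclic group of order m d the elements killed by m are the d-th powers.
    For d = q - 1 this is Hilbert 90 for L / F, for d = 2 it is Euler's criterion. *)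
Lemma finField_unity_power (L : finFieldType) (m d : nat) (x : L) :
  (m * d)%N = #|L|.-1 -> x ^+ m = 1 -> exists2 y : L, y != 0 & y ^+ d = x.
Proof.
move=> md xm; have [g gP] := finField_prim_root L.
have L1 := prim_order_gt0 gP.
have m0 : (0 < m)%N by move: L1; rewrite -md muln_gt0 => /andP[].
have g0 : g != 0.
  apply/eqP=> g0; move: (prim_expr_order gP); rewrite g0 expr0n gtn_eqF //.
  by move/eqP; rewrite eq_sym oner_eq0.
have /(prim_rootP gP)[i gi] : x ^+ #|L|.-1 = 1 by rewrite -md exprM xm expr1n.
have : (m * d %| i * m)%N by rewrite md (prim_order_dvd gP) exprM -gi xm.
rewrite mulnC dvdn_pmul2r // => /dvdnP[j ij].
by exists (g ^+ j); rewrite ?expf_neq0 // -exprM -ij.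
Qed.

(** * The cubic fibres and their discriminant *)

Section Cubic.
Variable K : fieldType.
Implicit Types a b c t x y z : K.

(** The numerator of c - g for g = (a X^2 + b X + 1) / (X^3 + b X^2 + a X): its
    roots are the fibre of g over c. *)
Definition fibre a b c x := c * x ^+ 3 + (b * c - a) * x ^+ 2 + (a * c - b) * x - 1.

(** The coefficients of the discriminant of the fibre cubic, as a polynomial in c.
    That polynomial is palindromic because inversion, applied to both x and c,
    preserves the family of fibres. Its odd coefficients are even multiples, and
    disc1 is half of them. *)
Definition disc0 a b := a ^+ 2 * (b ^+ 2 - 4%:R * a).
Definition disc1 a b :=
  b * (- a ^+ 3 - a * b ^+ 2 + 6%:R * a ^+ 2 + 2%:R * b ^+ 2 - 9%:R * a).
Definition disc2 a b :=
  a ^+ 4 + b ^+ 4 + 4%:R * a ^+ 2 * b ^+ 2 - 24%:R * a * b ^+ 2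
  + 18%:R * a ^+ 2 + 18%:R * b ^+ 2 - 27%:R.

Definition quartic d0 d1 d2 t : K :=
  d0 + 2%:R * d1 * t + d2 * t ^+ 2 + 2%:R * d1 * t ^+ 3 + d0 * t ^+ 4.
Definition quartic' d0 d1 d2 t : K :=
  2%:R * d1 + 2%:R * d2 * t + 6%:R * d1 * t ^+ 2 + 4%:R * d0 * t ^+ 3.

Definition disc a b := quartic (disc0 a b) (disc1 a b) (disc2 a b).
Definition disc' a b := quartic' (disc0 a b) (disc1 a b) (disc2 a b).

(** Vieta's relations for the roots x, y, z of the fibre over c. *)
Definition splits a b c x y z :=
  [/\ a - b * c = c * (x + y + z), a * c - b = c * (x * y + y * z + z * x)
    & 1 = c * (x * y * z)].

Lemma splits_fibre a b c x y z t : splits a b c x y z ->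
  fibre a b c t = c * (t - x) * (t - y) * (t - z).
Proof.
by case=> E1 E2 E3; rewrite /fibre -[b * c - a]opprB E1 E2 E3; ring.
Qed.

(** The discriminant of r X^3 + s X^2 + t X + u. *)
Definition cubic_disc (r s t u : K) : K :=
  s ^+ 2 * t ^+ 2 - 4%:R * r * t ^+ 3 - 4%:R * s ^+ 3 * u
  - 27%:R * r ^+ 2 * u ^+ 2 + 18%:R * r * s * t * u.

(** The derivative of the discriminant along the direction (1, b, a, 0), in which
    the coefficients of the fibre move with c. *)
Definition cubic_disc' (a b r s t u : K) : K :=
  2%:R * s * t * (b * t + a * s) - 4%:R * t ^+ 3 - 12%:R * r * a * t ^+ 2
  - 12%:R * b * s ^+ 2 * u - 54%:R * r * u ^+ 2
  + 18%:R * s * t * u + 18%:R * r * (b * t + a * s) * u.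

Lemma disc_splits a b c x y z : splits a b c x y z ->
  disc a b c = (c ^+ 2 * (x - y) * (x - z) * (y - z)) ^+ 2.
Proof.
case=> E1 E2 E3.
have -> : disc a b c = cubic_disc c (b * c - a) (a * c - b) (- 1).
  by rewrite /disc /quartic /disc0 /disc1 /disc2 /cubic_disc; ring.
by rewrite -[b * c - a]opprB E1 E2 [in - 1]E3 /cubic_disc; ring.
Qed.

(** The gradient of the discriminant vanishes at a perfect cube, so a triple root
    over c makes c a multiple zero of the discriminant. *)
Lemma disc'_triple a b c x : splits a b c x x x -> disc' a b c = 0.
Proof.
case=> E1 E2 E3.
have -> : disc' a b c = cubic_disc' a b c (b * c - a) (a * c - b) (- 1).
  by rewrite /disc' /quartic' /disc0 /disc1 /disc2 /cubic_disc'; ring.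
by rewrite -[b * c - a]opprB E1 E2 [in - 1]E3 /cubic_disc'; ring.
Qed.

Lemma splits_two_roots a b c x y : c != 0 -> x != y ->
  fibre a b c x = 0 -> fibre a b c y = 0 -> exists z, splits a b c x y z.
Proof.
rewrite -[x == y]subr_eq0 => c0 xy Fx Fy; exists ((a - b * c) / c - x - y).
have E : c * (x ^+ 2 + x * y + y ^+ 2) + (b * c - a) * (x + y) + (a * c - b) = 0.
  by apply: (mulfI xy); rewrite mulr0 -[RHS](subrr 0) -{1}Fx -Fy /fibre; ring.
have E2 : a * c - b = - (c * (x ^+ 2 + x * y + y ^+ 2)) - (b * c - a) * (x + y).
  by rewrite -[LHS]subr0 -E; ring.
split; first by field.
  by rewrite E2; field.
by rewrite -[LHS]addr0 -Fx /fibre E2; field.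
Qed.
End Cubic.

(** * Roots of norm one of a fibre *)

Section Unitary.
Variables (K : fieldType) (conj : {rmorphism K -> K}).
Hypothesis K2 : 2%:R != 0 :> K.
Implicit Types a b c t x y z w : K.

Definition unitary x := x * conj x == 1.

Lemma unitary_neq0 x : unitary x -> x != 0.
Proof.
by apply: contraTneq => ->; rewrite /unitary mul0r eq_sym oner_eq0.
Qed.

Lemma conj_unitary x : unitary x -> conj x = x^-1.
Proof.
move=> ux; have x0 := unitary_neq0 ux.
by apply: (mulfI x0); rewrite (eqP ux) divff.
Qed.

Lemma unitaryV x : unitary x -> unitary x^-1.
Proof. by rewrite /unitary fmorphV -invfM => /eqP->; rewrite invr1. Qed.

Lemma unitaryM x y : unitary x -> unitary y -> unitary (x * y).
Proof.
by rewrite /unitary rmorphM mulrACA => /eqP-> /eqP->; rewrite mulr1.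
Qed.

Lemma unitary1 : unitary 1.
Proof. by rewrite /unitary rmorph1 mulr1. Qed.

Lemma splits_neq0 a b c x y z : splits a b c x y z ->
  [/\ c != 0, x != 0, y != 0 & z != 0].
Proof.
by case=> _ _ /esym/eqP E; split; apply: contraTneq E => ->;
  rewrite ?(mul0r, mulr0) eq_sym oner_eq0.
Qed.

Lemma splits_c a b c x y z : splits a b c x y z -> c = (x * y * z)^-1.
Proof.
move=> S; have [c0 x0 y0 z0] := splits_neq0 S; case: S => _ _ E.
have xyz0 : x * y * z != 0 by rewrite !mulf_neq0.
by apply: (mulIf xyz0); rewrite mulVf // -E.
Qed.

Lemma splits_third a b c x y z : splits a b c x y z -> z = (c * x * y)^-1.
Proof.
move=> S; have [c0 x0 y0 z0] := splits_neq0 S.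
by rewrite (splits_c S); field; rewrite ?x0 ?y0 ?z0 ?oner_eq0.
Qed.

(** d / c is sent to its opposite by the conjugation and w is fixed, so they can
    only agree up to sign when both vanish. *)
Lemma antifixed_square_eq0 c d w :
    unitary c -> conj w = w -> conj d = - d / c ^+ 2 -> d ^+ 2 = (c * w) ^+ 2 ->
  w = 0.
Proof.
move=> uc ww conjd dE; have c0 := unitary_neq0 uc.
have : conj (c * w) = - (c * w) / c ^+ 2.
  move/eqP: dE; rewrite eqf_sqr => /orP[] /eqP E; first by rewrite -E conjd.
  by rewrite -[c * w]opprK -E rmorphN conjd opprK mulNr opprK.
have -> : conj (c * w) = (c * w) / c ^+ 2.
  by rewrite rmorphM ww conj_unitary //; field.
move=> /(mulIf _)-/(_ (invr_neq0 (expf_neq0 2 c0)))/eqP.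
rewrite -subr_eq0 opprK -mulr2n -mulr_natl !mulf_eq0.
by rewrite (negPf K2) (negPf c0) => /eqP.
Qed.

(** Two distinct roots of norm one force the third one, of product 1 / c with
    them, to have norm one as well. The conjugation then inverts all three roots,
    so that a square root of the discriminant is c times an antifixed element; if
    the discriminant is also (c w)^2 with w fixed, it vanishes. The relation
    required when w = 0 says that (x - y)^2 = 0 for the double root x and the
    remaining root y. *)
Lemma unitary_fibre_inj a b c w x y :
    unitary c -> conj w = w -> disc a b c = (c * w) ^+ 2 ->
    (w = 0 -> (b * c - a) ^+ 2 = 3%:R * c * (a * c - b)) ->
    unitary x -> unitary y -> fibre a b c x = 0 -> fibre a b c y = 0 -> x = y.
Proof.
move=> uc ww Dw w0 ux uy Fx Fy; apply/eqP/contraT => xy.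
have [z S] := splits_two_roots (unitary_neq0 uc) xy Fx Fy.
have [c0 x0 y0 z0] := splits_neq0 S.
have uz : unitary z by rewrite (splits_third S) unitaryV ?unitaryM.
set d := c ^+ 2 * (x - y) * (x - z) * (y - z).
have conjd : conj d = - d / c ^+ 2.
  rewrite /d !(rmorphE, rmorphM) /= !conj_unitary // (splits_c S).
  by field; rewrite ?x0 ?y0 ?z0 ?oner_eq0.
have cw0 : w = 0.
  by apply: (antifixed_square_eq0 uc ww conjd); rewrite -Dw (disc_splits S).
have d0 : d == 0 by rewrite -sqrf_eq0 /d -(disc_splits S) Dw cw0 mulr0 expr0n.
have /eqP E : c ^+ 2 * ((x + y + z) ^+ 2 - 3%:R * (x * y + y * z + z * x)) = 0.
  rewrite -[RHS](subrr (3%:R * c * (a * c - b))) -{1}(w0 cw0).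
  by rewrite -[b * c - a]opprB; case: S => -> -> _; ring.
have c20 : c ^+ 2 != 0 by rewrite expf_neq0.
have : (x - y) ^+ 2 == 0.
  move: E; rewrite mulf_eq0 (negPf c20) => /eqP E.
  have : (x - z) * (y - z) == 0.
    rewrite -(mulrI_eq0 _ (mulfI (_ : c ^+ 2 * (x - y) != 0))).
      by rewrite mulrA -/d.
    by rewrite mulf_neq0 // subr_eq0.
  rewrite mulf_eq0 !subr_eq0 /=.
  by case/orP => /eqP xyz; rewrite -E ?xyz -?xyz; apply/eqP; ring.
by rewrite sqrf_eq0 subr_eq0 (negPf xy).
Qed.

Hypothesis unitary_sqrt : forall d p, unitary p -> conj d = d / p ^+ 2 ->
  exists r, r ^+ 2 = d.

(** The map x |-> 1 / conj x permutes the roots of the fibre. If x is its only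
    fixed point, then, unless x is a triple root, it exchanges the other roots y and z, and
    c (x - y) (x - z) (y - z) is fixed by the conjugation. The roots y and z lie in
    K because the discriminant of the residual quadratic is, up to the square of
    a norm-one element, its own conjugate. *)
Lemma disc_one_unitary_root a b c x :
    conj a = a -> conj b = b -> unitary c -> unitary x -> fibre a b c x = 0 ->
    (forall y, unitary y -> fibre a b c y = 0 -> y = x) ->
  (exists w, [/\ w != 0, conj w = w & disc a b c = (c * w) ^+ 2]) \/
  splits a b c x x x.
Proof.
move=> ca cb uc ux Fx uniqx.
have [c0 x0] := (unitary_neq0 uc, unitary_neq0 ux).
(* The sum and the product of the two other roots. *)
set s := (a - b * c) / c - x; set p := (c * x)^-1.
have up : unitary p by rewrite unitaryV ?unitaryM.
have p0 := unitary_neq0 up.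
have x3 : x ^+ 3 * c = 1 - (b * c - a) * x ^+ 2 - (a * c - b) * x.
  by rewrite -[RHS]addr0 -Fx /fibre; ring.
have conjs : conj s = s / p.
  rewrite /s /p !(rmorphE, rmorphM, fmorphV) /= ca cb !conj_unitary //.
  have -> : ((a - b * c) / c - x) / (c * x)^-1 = (a - b * c) * x - x ^+ 3 * c / x.
    by field; rewrite ?c0 ?x0 ?oner_eq0.
  by rewrite x3; field; rewrite ?c0 ?x0 ?oner_eq0.
have [||r rE] := @unitary_sqrt (s ^+ 2 - 4%:R * p) p; first by [].
  rewrite rmorphB rmorphXn conjs rmorphM rmorph_nat (conj_unitary up).
  by field; rewrite ?p0 ?oner_eq0.
set y := (s + r) / 2%:R; set z := (s - r) / 2%:R.
have yzD : y + z = s by rewrite /y /z; field.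
have K4 : 4%:R != 0 :> K by rewrite -[4%N]/(2 * 2)%N natrM mulf_neq0.
have yzM : y * z = p.
  have -> : y * z = (s ^+ 2 - r ^+ 2) / 4%:R.
    by rewrite /y /z; field; rewrite ?K2 ?K4.
  by rewrite rE; field; rewrite ?K4.
clearbody y z.
have S : splits a b c x y z.
  split.
  - by rewrite -addrA yzD /s; field; rewrite ?c0.
  - have -> : x * y + y * z + z * x = x * (y + z) + y * z by ring.
    have -> : a * c - b = (1 - c * x ^+ 3 - (b * c - a) * x ^+ 2) / x.
      apply: (mulIf x0); rewrite mulfVK // -[LHS]subr0 -Fx /fibre; ring.
    by rewrite yzD yzM /s /p; field; rewrite ?c0 ?x0 ?oner_eq0.
  by rewrite -(mulrA x) yzM mulrA /p mulfV // mulf_neq0.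
have [_ _ y0 z0] := splits_neq0 S.
have [uy|nuy] := boolP (unitary y).
  have yx : y = x by apply: uniqx; rewrite // (splits_fibre _ S) subrr mulr0 mul0r.
  have uz : unitary z.
    by rewrite (splits_third S); apply/unitaryV/unitaryM/uy/unitaryM.
  have zx : z = x by apply: uniqx; rewrite // (splits_fibre _ S) subrr mulr0.
  by right; move: S; rewrite yx zx.
(* 1 / conj y is y or z, being a root of the residual quadratic. *)
have cyE : conj y = z^-1.
  have czE : conj z = s / p - conj y.
    by rewrite -conjs -yzD rmorphD addrAC subrr add0r.
  have /eqP : (y * conj y - 1) * (z * conj y - 1) = 0.
    have : conj (y * z) = p^-1 by rewrite yzM conj_unitary.
    rewrite rmorphM czE => E.
    transitivity (1 - p * p^-1 ); last by rewrite divff // subrr.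
    rewrite -E -yzD -yzM; field.
    by rewrite ?y0 ?z0 ?oner_eq0.
  rewrite mulf_eq0 !subr_eq0 -/(unitary y) (negPf nuy) /= => /eqP zy.
  by apply: (mulfI z0); rewrite zy divff.
have czE : conj z = y^-1.
  have : conj (z * y) = (z * y)^-1 by rewrite mulrC yzM conj_unitary.
  by rewrite rmorphM cyE invfM mulrC => /(mulfI (invr_neq0 z0)).
left; exists (c * (x - y) * (x - z) * (y - z)); split.
- rewrite !mulf_neq0 // subr_eq0; apply: contra nuy.
  + by move/eqP=> <-.
  + move/eqP=> xz; suff <- : x = y by [].
    by apply: invr_inj; rewrite -(conj_unitary ux) xz czE.
  by move/eqP=> yz; rewrite /unitary cyE -yz divff.
- rewrite !rmorphM !rmorphB cyE czE !conj_unitary // (splits_c S).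
  by field; rewrite ?x0 ?y0 ?z0 ?oner_eq0.
by rewrite (disc_splits S); ring.
Qed.
End Unitary.

(** * Quartics with square values on the elements of norm one *)

Lemma dvdp_Xn_sub_1 (K : fieldType) (m : nat) (z : K) (p : {poly K}) :
    m.-primitive_root z -> (forall c, c ^+ m = 1 -> root p c) ->
  'X^m - 1 %| p.
Proof.
move=> zP rootp; rewrite -(factor_Xn_sub_1 zP) -(big_map (fun i => z ^+ i)
  predT (fun c => 'X - c%:P)).
apply: uniq_roots_dvdp.
  apply/allP=> _ /mapP[i _ ->]; apply: rootp.
  by rewrite exprAC (prim_expr_order zP) expr1n.
rewrite uniq_rootsE map_inj_in_uniq ?iota_uniq // => i j.
rewrite !mem_index_iota => /= im jm /eqP.
by rewrite (eq_prim_root_expr zP) !modn_small // => /eqP.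
Qed.

(** The roots of X^m - 1 are simple when m is invertible, and double zeros at all
    of them can be divided out twice. *)
Lemma dvdp_Xn_sub_1_sqr (K : fieldType) (m : nat) (z : K) (p : {poly K}) :
    m.-primitive_root z -> m%:R != 0 :> K ->
    (forall c, c ^+ m = 1 -> root p c /\ root p^`() c) ->
  ('X^m - 1) ^+ 2 %| p.
Proof.
move=> zP m0 rootp; have m_gt0 := prim_order_gt0 zP.
have /dvdpP[r pE] : 'X^m - 1 %| p by apply: (dvdp_Xn_sub_1 zP) => c /rootp[].
rewrite pE expr2 dvdp_mul // (dvdp_Xn_sub_1 zP) // => c cm.
have [_] := rootp c cm; rewrite pE derivM derivB derivXn derivC subr0 !rootE.
rewrite !hornerE hornerMn !hornerE cm subrr mulr0 add0r mulf_eq0 => /orP[//|].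
rewrite -mulr_natr mulf_eq0 (negPf m0) orbF expf_eq0 => /andP[_ /eqP c0].
by move: cm; rewrite c0 expr0n gtn_eqF // => /eqP; rewrite eq_sym oner_eq0.
Qed.

Section Key.
Variables (K : fieldType) (q n : nat).
Hypothesis qE : q = n.*2.+1.
Hypothesis pq : [pchar K].-nat q.
Hypothesis n_gt0 : (0 < n)%N.

Lemma pnat_natr0 : q%:R = 0 :> K.
Proof.
have [p pP] : exists p, p \in [pchar K].
  have q1 : (1 < q)%N by rewrite qE ltnS double_gt0.
  exists (pdiv q); apply: (pnatPpi pq).
  by rewrite pi_pdiv.
have : (p %| q)%N.
  move: pq; rewrite (eq_pnat _ (pcharf_eq pP)) => /p_natP[k E].
  rewrite E; case: k E => [|k] E; last by rewrite expnS dvdn_mulr.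
  by move: n_gt0; rewrite -double_gt0; move: E; rewrite qE expn0 => -[->].
by rewrite (dvdn_pcharf pP) => /eqP.
Qed.

(** n + 1 = (q + 1) / 2 is the exponent of Euler's criterion plus one; its image in
    K is 1/2. *)
Lemma half_q : n.+1%:R * 2%:R = 1 :> K.
Proof. by rewrite -natrM muln2 doubleS -qE -addn1 natrD pnat_natr0 add0r. Qed.

Lemma char_neq2 : 2%:R != 0 :> K.
Proof.
by apply: contra_eq_neq half_q => ->; rewrite mulr0 eq_sym oner_eq0.
Qed.

Variable (z : K).
Hypothesis zP : q.+1.-primitive_root z.

(** A palindromic quartic D such that D(c) / c^2 is a nonzero square of F_q
    for all c of norm one, multiple zeros excepted, is essentially a multiple of a
    square.

    Let P(t, T) be T^2 times the polarization of D at (t, 1 / T): it has bidegree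
    (2, 2) and P(c, 1 / c) = D(c) / c^2. By Euler's criterion
    P(t, t^q) - D(t)^((q + 1) / 2) vanishes at every c of norm one, and twice, since
    the derivatives of both terms are half of D'(c) / c^2. So it is divisible by
    (t^(q + 1) - 1)^2, and its degree is not larger: it equals k (t^(q + 1) - 1)^2.
    Hence D(t)^((q + 1) / 2) = P(t, t^q) - k (t t^q - 1)^2, and squaring gives
      (P(t, t^q) - k (t t^q - 1)^2)^2 = D(t) D(t^q).
    Reduction modulo t^q compares the squares of the parts without t^q:
      (d0 t^2 + d1 t - k)^2 = d0 D(t),
    an equality of polynomials since both sides have the same coefficients in
    degrees 3 and 4, and q > 2.

    This replaces the Hasse bound for the genus-one curve y^2 = D(t): the quotient of
    P(t, t^q) - D^((q + 1) / 2) by (t^(q + 1) - 1)^2 is an abscissa, on the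
    Jacobian, of the difference of the generic point and its Frobenius image. *)
Lemma quartic_square_values (d0 d1 d2 : K) :
    d0 ^+ q = d0 -> d1 ^+ q = d1 -> d2 ^+ q = d2 ->
    (forall c, c ^+ q.+1 = 1 ->
      (exists w, [/\ w != 0, w ^+ q = w & quartic d0 d1 d2 c = (c * w) ^+ 2]) \/
      (quartic d0 d1 d2 c = 0 /\ quartic' d0 d1 d2 c = 0)) ->
  exists k, [/\ k ^+ 2 = d0 ^+ 2, (k + d0) * d1 = 0
              & d1 ^+ 2 - 2%:R * k * d0 = d0 * d2].
Proof.
move=> d0q d1q d2q sq.
(* T is t^q; the polynomials are kept abstract to control their unfolding. *)
have [T TE] : {T : {poly K} | T = 'X^q} by exists 'X^q.
have [D DE] : {D : {poly K} | D = d0%:P + 2%:R * d1%:P * 'X + d2%:P * 'X ^+ 2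
  + 2%:R * d1%:P * 'X ^+ 3 + d0%:P * 'X ^+ 4} by eexists.
have [P PE] : {P : {poly K} | P = d0%:P * T ^+ 2 + d1%:P * ('X * T ^+ 2 + T)
  + d2%:P * ('X * T) + d1%:P * ('X ^+ 2 * T + 'X) + d0%:P * 'X ^+ 2} by eexists.
pose N := P - D ^+ n.+1.
have Dc c : D.[c] = quartic d0 d1 d2 c by rewrite DE /quartic -!polyC_natr !hornerE.
have D'c c : D^`().[c] = quartic' d0 d1 d2 c.
  by rewrite DE /quartic' -!polyC_natr !derivE !hornerE /=; ring.
have T' : 'X^(q.-1) *+ q = 0 :> {poly K}.
  by rewrite -mulr_natr -polyC_natr pnat_natr0 mulr0.
have P'c c : P^`().[c] = d1 * (c ^+ q) ^+ 2 + d2 * c ^+ q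
   + d1 * (2%:R * c * c ^+ q + 1) + 2%:R * d0 * c.
  rewrite PE TE !derivE !T' !(mul0r, mulr0, addr0, mul1r, add0r).
  by rewrite !(hornerE, hornerMn) /=; ring.
have sizeD : (size D <= 5)%N.
  have -> : D = Poly [:: d0; 2%:R * d1; d2; 2%:R * d1; d0].
    by rewrite DE /= !cons_poly_def -polyC_natr !polyCM; ring.
  exact: size_Poly.
have sizeN : (size N <= (q.+1).*2.+1)%N.
  have szD (r s : {poly K}) m : (size r <= m -> size s <= m -> size (r + s)%R <= m)%N.
    by move=> rm sm; rewrite (leq_trans (size_polyD _ _)) // geq_max rm.
  have sizeP : (size P <= (q.+1).*2.+1)%N.
    have -> : P = Poly [:: 0; d1; d0] + Poly [:: d1; d2; d1] * 'X^q
                  + Poly [:: d0; d1] * 'X^q * 'X^q.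
      by rewrite PE TE /= !cons_poly_def; ring.
    have sz (s : seq K) m : (size (Poly s * 'X^m)%R <= size s + m)%N.
      apply: leq_trans (size_polyMleq _ _) _; rewrite size_polyXn addnS /=.
      by rewrite leq_add2r size_Poly.
    rewrite -mulrA -exprD !szD ?(leq_trans (size_Poly _)) ?(leq_trans (sz _ _)) //=;
      rewrite qE; lia.
  rewrite szD // size_polyN.
  apply: leq_trans (size_poly_exp_leq _ _) _; rewrite ltnS.
  apply: leq_trans (leq_mul (_ : _ <= 4)%N (leqnn _)) _; last by rewrite qE; lia.
  by move: sizeD; case: (size D).
have dvdN : ('X^(q.+1) - 1) ^+ 2 %| N.
  apply: (dvdp_Xn_sub_1_sqr zP) => [|c cq].
    by rewrite -addn1 natrD pnat_natr0 add0r oner_eq0.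
  have c0 : c != 0.
    by apply: contra_eq_neq cq => ->; rewrite expr0n eq_sym oner_eq0.
  have cqV : c ^+ q = c^-1 by apply: (mulfI c0); rewrite -exprS cq divff.
  have Pc : P.[c] = quartic d0 d1 d2 c / c ^+ 2.
    by rewrite PE TE !hornerE cqV /quartic /=; field; rewrite ?c0 ?oner_eq0.
  have {}P'c : P^`().[c] * 2%:R = quartic' d0 d1 d2 c / c ^+ 2.
    by rewrite P'c cqV /quartic'; field; rewrite ?c0 ?oner_eq0.
  have halve (x : K) : x * 2%:R * n.+1%:R = x.
    by rewrite -mulrA [2%:R * _]mulrC half_q mulr1.
  have K2 := char_neq2.
  rewrite !rootE /N derivB deriv_exp.
  rewrite !(hornerE, hornerMn, horner_exp) D'c Dc Pc /=.
  case: (sq c cq) => [[w [w0 wq QE]]|[-> Q'0]]; last first.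
    split; first by rewrite mul0r expr0n subrr.
    rewrite Q'0 mul0r mul0rn subr0; apply/eqP/(mulIf K2).
    by rewrite P'c Q'0 !mul0r.
  have Qn : quartic d0 d1 d2 c ^+ n = c ^- 2.
    rewrite QE -exprM mul2n; apply: (mulIf (_ : c * w != 0)).
      by rewrite mulf_neq0.
    by rewrite -exprSr -qE exprMn wq cqV; field; rewrite ?c0.
  split; first by rewrite (exprS _ n) Qn subrr.
  rewrite Qn.
  by rewrite -P'c -mulr_natr halve subrr.
have sizeU : size ('X^(q.+1) - 1 : {poly K}) = q.+2 by rewrite size_XnsubC.
have monU : ('X^(q.+1) - 1 : {poly K}) \is monic by rewrite monicXnsubC.
have [k NE] : exists k, N = k%:P * ('X^(q.+1) - 1) ^+ 2.
  have /dvdpP[M NE] := dvdN.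
  suff /size1_polyC ME : (size M <= 1)%N by exists M`_0; rewrite -ME.
  have [->|M0] := eqVneq M 0; first by rewrite size_poly0.
  move: sizeN; rewrite NE size_Mmonic ?monic_exp // expr2 size_Mmonic ?monic_neq0 //.
  by rewrite sizeU; lia.
have DqE : D ^+ q = d0%:P + 2%:R * d1%:P * T + d2%:P * T ^+ 2
  + 2%:R * d1%:P * T ^+ 3 + d0%:P * T ^+ 4.
  have pqP : [pchar {poly K}].-nat q by rewrite (eq_pnat _ (pchar_lalg _)).
  have monq d m : d ^+ q = d -> (d%:P * 'X ^+ m) ^+ q = d%:P * T ^+ m :> {poly K}.
    by move=> dq; rewrite exprMn -rmorphXn /= dq exprAC TE.
  have dd1q : (2%:R * d1) ^+ q = 2%:R * d1.
    by rewrite mulr_natl mulr2n exprDn_pchar // d1q.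
  have -> : D = d0%:P * 'X ^+ 0 + (2%:R * d1)%:P * 'X ^+ 1 + d2%:P * 'X ^+ 2
      + (2%:R * d1)%:P * 'X ^+ 3 + d0%:P * 'X ^+ 4.
    by rewrite DE polyCM polyC_natr expr0 expr1 mulr1.
  by rewrite !exprDn_pchar // !monq // polyCM polyC_natr expr0 expr1 mulr1.
pose G := P - k%:P * ('X * T - 1) ^+ 2.
have GD : G ^+ 2 = D * D ^+ q.
  have -> : G = D ^+ n.+1.
    have -> : D ^+ n.+1 = P - N by rewrite /N opprB addrC subrK.
    by rewrite NE /G TE (exprS _ q).
  by rewrite -exprM muln2 doubleS -qE (exprS _ q).
set P0 := (d0%:P * 'X ^+ 2 + d1%:P * 'X - k%:P) ^+ 2 - d0%:P * D.
have P0E : P0 = Poly [:: k ^+ 2 - d0 ^+ 2; - (2%:R * ((k + d0) * d1));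
    d1 ^+ 2 - 2%:R * k * d0 - d0 * d2].
  rewrite /P0 DE /= !cons_poly_def !(polyCB, polyCN, polyCD, polyCM, polyC_exp).
  by rewrite -polyC_natr; ring.
have dvdP0 : 'X^q %| P0.
  (* g and r collect the terms of G and D ^+ q that are divisible by T. *)
  pose g := d1%:P + d2%:P * 'X + d1%:P * 'X ^+ 2 + 2%:R * k%:P * 'X
    + (d0%:P + d1%:P * 'X - k%:P * 'X ^+ 2) * T.
  pose r := 2%:R * d1%:P + d2%:P * T + 2%:R * d1%:P * T ^+ 2 + d0%:P * T ^+ 3.
  apply/dvdpP; exists (D * r - g * (2%:R * (d0%:P * 'X ^+ 2 + d1%:P * 'X - k%:P) + T * g)).
  rewrite -TE -[LHS]subr0 -(subrr (G ^+ 2)) {2}GD DqE /P0 /r /G PE /g; ring.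
(* P0 has degree at most 2, less than q. *)
have P00 : P0 = 0.
  apply/eqP/contraT => P0n0; move: (dvdp_leq P0n0 dvdP0).
  rewrite size_polyXn P0E leqNgt ltnS (leq_trans (size_Poly _)) //=.
  by rewrite qE; move: n_gt0; lia.
have coefP0 i := congr1 (fun p : {poly K} => p`_i) P00.
move: (coefP0 0%N) (coefP0 1%N) (coefP0 2%N); rewrite P0E !coef_Poly !coef0 /=.
move=> /eqP; rewrite subr_eq0 => /eqP E0 /eqP.
rewrite oppr_eq0 mulf_eq0 (negPf char_neq2) /= => /eqP E1 /eqP.
by rewrite subr_eq0 => /eqP E2; exists k.
Qed.
End Key.

(** * Permutations of the elements of norm one *)

Section Core.
Variables (L : finFieldType) (q n : nat) (conj : {rmorphism L -> L}).
Hypothesis qE : q = n.*2.+1.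
Hypothesis n_gt0 : (0 < n)%N.
Hypothesis card_L : #|L| = (q ^ 2)%N.
Hypothesis conjE : forall x, conj x = x ^+ q.
Implicit Types a b c u v w x y z : L.

Local Notation mu := (unitary conj).
Let pq : [pchar L].-nat q := pnat_sqrt_card card_L.
Let L2 : 2%:R != 0 :> L := char_neq2 qE pq n_gt0.

Lemma card_L_unit : (q.+1 * q.-1)%N = #|L|.-1.
Proof. by rewrite card_L qE; lia. Qed.

Lemma unitaryE u : mu u = (u ^+ q.+1 == 1).
Proof. by rewrite /unitary conjE exprS. Qed.

Lemma unitary_prim_root : exists z, q.+1.-primitive_root z.
Proof.
have [g gP] := finField_prim_root L.
exists (g ^+ (#|L|.-1 %/ q.+1)); apply: dvdn_prim_root => //.
by rewrite -card_L_unit dvdn_mulr.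
Qed.

Lemma unitary_Hilbert90 u : mu u -> exists2 x, x != 0 & x ^+ q.-1 = u.
Proof. by rewrite unitaryE => /eqP; apply: finField_unity_power card_L_unit. Qed.

(** For d != 0 the hypothesis reads d^(q - 1) = p^-2, whence d^((q^2 - 1) / 2) = 1. *)
Lemma unitary_sqrt d p : mu p -> conj d = d / p ^+ 2 ->
  exists r, r ^+ 2 = d.
Proof.
move=> up dE; have p0 := unitary_neq0 up.
have [->|d0] := eqVneq d 0; first by exists 0; rewrite expr0n.
have [||r _ rE] := @finField_unity_power L (n * q.+1) 2 d; last by exists r.
  by rewrite -card_L_unit qE; lia.
have dn : d ^+ q.-1 = p ^- 2.
  apply: (mulIf d0); rewrite -exprSr prednK ?qE // -qE -conjE dE.
  by rewrite mulrC.
apply: (mulIf (_ : p ^+ q.+1 != 0)); first by rewrite expf_neq0.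
have n2 : (n * q.+1 = q.-1 * n.+1)%N by rewrite qE; lia.
rewrite n2 exprM dn exprVn -exprM mul2n doubleS -qE mulVf ?expf_neq0 //.
by move: up; rewrite unitaryE => /eqP->; rewrite mulr1.
Qed.

Lemma unitary_nonroot (p : {poly L}) : p != 0 -> (size p <= 3)%N ->
  exists2 c, mu c & ~~ root p c.
Proof.
move=> p0 p3; have [c /andP[uc pc]|H] := pickP [pred c | mu c && ~~ root p c].
  by exists c.
have [z zP] := unitary_prim_root.
have /dvdp_leq-/(_ p0) : 'X^(q.+1) - 1 %| p.
  apply: (dvdp_Xn_sub_1 zP) => c /eqP cq.
  by move: (H c); rewrite /= unitaryE cq => /negbFE.
by rewrite size_XnsubC // => /leq_trans/(_ p3); rewrite qE; lia.
Qed.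

Lemma char_eq3 : (q %% 3 = 0)%N -> 3%:R = 0 :> L.
Proof.
move=> q3; apply/eqP; have : 3%N \in [pchar L].
  by apply: (pnatPpi pq); rewrite mem_primes /= /dvdn q3 qE.
by rewrite inE => /andP[].
Qed.

(** r = 2 o + 1 for a primitive cube root of unity o, which the conjugation fixes or
    inverts according to q modulo 3. *)
Lemma sqrt_m3 : (q %% 3 <> 0)%N ->
  exists r, r ^+ 2 = - 3%:R /\ conj r = if (q %% 3 == 1)%N then r else - r.
Proof.
move=> q3; have [g gP] := finField_prim_root L.
have d3 : (3 %| #|L|.-1)%N by rewrite -card_L_unit Euclid_dvdM //; move: qE q3; lia.
have := dvdn_prim_root gP d3; set o := g ^+ _ => oP.
have o3 := prim_expr_order oP.
have o1 : o != 1.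
  by rewrite -[o]expr1 -[1](expr0 o) (eq_prim_root_expr oP).
have oE : o ^+ 2 = - 1 - o.
  apply: (mulIf (_ : o - 1 != 0)); first by rewrite subr_eq0.
  by transitivity (o ^+ 3 - o ^+ 2); [ring | rewrite o3; ring].
exists (2%:R * o + 1); split.
  have -> : (2%:R * o + 1) ^+ 2 = 4%:R * o ^+ 2 + 4%:R * o + 1 by ring.
  by rewrite oE; ring.
rewrite rmorphD rmorphM rmorph_nat rmorph1 conjE -(prim_expr_mod oP).
case: eqP => [->|q1]; first by rewrite expr1.
have -> : (q %% 3 = 2)%N by lia.
by rewrite oE; ring.
Qed.

(** The trinomial is x * hpol (x^(q - 1)). *)
Definition hpol a b u : L := u ^+ 2 + b * u + a.

(** The map u |-> u * (hpol u)^(q - 1) that the trinomial induces on (q - 1)-th powers. *)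
Definition gmap a b u : L := u * conj (hpol a b u) / hpol a b u.

Definition unitary_perm a b :=
  (forall u, mu u -> hpol a b u != 0) /\
  (forall u v, mu u -> mu v -> gmap a b u = gmap a b v -> u = v).

Section Coef.
Variables (a b : L).
Hypotheses (conja : conj a = a) (conjb : conj b = b).

Lemma conj_hpol u : mu u -> conj (hpol a b u) = (a * u ^+ 2 + b * u + 1) / u ^+ 2.
Proof.
move=> uu; have u0 := unitary_neq0 uu.
rewrite /hpol !rmorphD rmorphM rmorphXn conja conjb conj_unitary //.
by field; rewrite ?u0 ?oner_eq0.
Qed.

Lemma gmap_fibre c u : mu u -> hpol a b u != 0 ->
  (fibre a b c u == 0) = (c == gmap a b u).
Proof.
move=> uu h0; have u0 := unitary_neq0 uu.
have -> : fibre a b c u = u * (c * hpol a b u - u * conj (hpol a b u)).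
  by rewrite conj_hpol // /fibre /hpol; field; rewrite ?u0 ?oner_eq0.
by rewrite mulf_eq0 (negPf u0) subr_eq0 -(can2_eq (mulfK h0) (divfK h0)).
Qed.

Lemma gmap_unitary u : mu u -> hpol a b u != 0 -> mu (gmap a b u).
Proof.
move=> uu h0; have u0 := unitary_neq0 uu.
have ch0 : conj (hpol a b u) != 0 by rewrite fmorph_eq0.
have conjK x : conj (conj x) = x.
  by rewrite !conjE -exprM -[(q * q)%N]/(q ^ 2)%N -card_L expf_card.
rewrite /unitary /gmap !rmorphM fmorphV conjK conj_unitary //.
by apply/eqP; field; rewrite ?u0 ?h0 ?ch0.
Qed.

Lemma unitary_perm_fibre c : unitary_perm a b -> mu c ->
  exists x, [/\ mu x, fibre a b c x = 0
    & forall y, mu y -> fibre a b c y = 0 -> y = x].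
Proof.
move=> [h0 ginj] uc; pose U := [set u | mu u].
have gU : gmap a b @: U = U.
  apply/eqP; rewrite eqEcard card_in_imset ?leqnn ?andbT.
    by apply/subsetP => _ /imsetP[u + ->]; rewrite !inE => uu; rewrite gmap_unitary ?h0.
  by move=> u v; rewrite !inE; apply: ginj.
have : c \in gmap a b @: U by rewrite gU inE.
case/imsetP => x; rewrite inE => ux cE.
exists x; split=> //; first by apply/eqP; rewrite gmap_fibre ?h0 // cE.
move=> y uy /eqP; rewrite gmap_fibre ?h0 // => /eqP yE.
by apply: ginj; rewrite // -yE.
Qed.

(** Both possibilities of disc_one_unitary_root, in the form expected by
    quartic_square_values. *)
Lemma unitary_perm_disc c : unitary_perm a b -> mu c ->
  (exists w, [/\ w != 0, conj w = w & disc a b c = (c * w) ^+ 2]) \/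
  (disc a b c = 0 /\ disc' a b c = 0).
Proof.
move=> ab uc; have [x [ux Fx uniqx]] := unitary_perm_fibre ab uc.
have [|S] := disc_one_unitary_root L2 unitary_sqrt conja conjb uc ux Fx uniqx.
  by left.
right; split; last exact: disc'_triple S.
by rewrite (disc_splits S) subrr !mulr0 expr0n.
Qed.

Lemma conj_disc_coef : [/\ conj (disc0 a b) = disc0 a b,
  conj (disc1 a b) = disc1 a b & conj (disc2 a b) = disc2 a b].
Proof.
rewrite /disc0 /disc1 /disc2.
by split; rewrite !(rmorphE, rmorphM) /= ?rmorph_nat ?conja ?conjb.
Qed.

(** A quarter of the discriminant of disc / c^2, a quadratic polynomial in c + 1 / c. Its
    vanishing, which makes the quartic a multiple of a square, yields the first two
    families of coefficients. *)
Lemma disc_coef_discr : disc1 a b ^+ 2 + 2%:R * disc0 a b ^+ 2 - disc0 a b * disc2 a b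
  = - 4%:R * (a - 1) * (b ^+ 2 - (a ^+ 2 + 3%:R * a)) ^+ 3.
Proof. by rewrite /disc0 /disc1 /disc2; ring. Qed.

Lemma char_neq3 : (q %% 3 <> 0)%N -> 3%:R != 0 :> L.
Proof.
move=> q3; apply/eqP => L3; case: q3.
have p3 : 3%N \in [pchar L] by rewrite inE L3 eqxx.
move: pq; rewrite (eq_pnat _ (pcharf_eq p3)) => /p_natP[[|k] E].
  by move: n_gt0; move: E; rewrite expn0 qE; lia.
by rewrite E expnS modnMr.
Qed.

Definition fixed_square (d : L) := exists v, [/\ v != 0, conj v = v & d = v ^+ 2].

Definition perm_coefs :=
  [\/ fixed_square (a * (a - 1)) /\ b ^+ 2 = a ^+ 2 + 3%:R * a,
      a = 1 /\ fixed_square (b ^+ 2 - 4%:R),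
      [/\ a = 3%:R, b = 0 & (q %% 3 = 2)%N]
    | [/\ a = 0, b = 0 & (q %% 3 <> 2)%N]].

(** Here the induced map is u |-> u^-3. *)
Lemma unitary_perm_cube : a = 0 -> b = 0 -> unitary_perm a b -> (q %% 3 <> 2)%N.
Proof.
move=> a0 b0 [_ ginj] q3.
have [z zP] := unitary_prim_root.
have d3 : (3 %| q.+1)%N by lia.
have oP := dvdn_prim_root zP d3; set o := z ^+ _ in oP.
have uo : mu o by rewrite unitaryE exprAC (prim_expr_order zP) expr1n.
have o0 := unitary_neq0 uo.
have : o = 1.
  apply: ginj; rewrite // ?/unitary ?rmorph1 ?mulr1 //.
  rewrite /gmap /hpol a0 b0 !mul0r !addr0 expr1n rmorph1 rmorphXn conj_unitary //.
  transitivity (o ^+ 3)^-1; first by field; rewrite ?o0 ?oner_eq0.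
  by rewrite (prim_expr_order oP) divr1 mulr1 invr1.
by move/eqP; rewrite -[o]expr1 -[1](expr0 o) (eq_prim_root_expr oP).
Qed.

(** Here disc = -108 (c^2 - 1)^2 = (6 r (c^2 - 1))^2 with r^2 = -3. If r were fixed by
    the conjugation, r (c - 1 / c) would be antifixed, and disc / c^2 not a square of
    a fixed element. *)
Lemma unitary_perm_three : a = 3%:R -> b = 0 -> disc0 a b != 0 ->
  unitary_perm a b -> (q %% 3 = 2)%N.
Proof.
move=> a3 b0 d0n0 ab.
have q30 : (q %% 3 <> 0)%N.
  by move/char_eq3 => L30; move/eqP: d0n0; apply; rewrite /disc0 a3 L30; ring.
have [r [r2 cr]] := sqrt_m3 q30; suff : (q %% 3 <> 1)%N by lia.
move=> q31; rewrite q31 eqxx in cr.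
have [||c uc] := @unitary_nonroot ('X ^+ 2 - 1).
- by rewrite -size_poly_eq0 size_XnsubC.
- by rewrite size_XnsubC.
have c0 := unitary_neq0 uc.
rewrite rootE !hornerE => c21.
have D : disc a b c = (6%:R * r * (c ^+ 2 - 1)) ^+ 2.
  have -> : (6%:R * r * (c ^+ 2 - 1)) ^+ 2 = 36%:R * r ^+ 2 * (c ^+ 2 - 1) ^+ 2 by ring.
  by rewrite r2 /disc /quartic /disc0 /disc1 /disc2 a3 b0; ring.
have cD : conj (6%:R * r * (c ^+ 2 - 1)) = - (6%:R * r * (c ^+ 2 - 1)) / c ^+ 2.
  rewrite !rmorphM rmorphB rmorphXn rmorph_nat rmorph1 cr conj_unitary //.
  by field; rewrite ?c0 ?oner_eq0.
have [[w [w0 cw Dw]]|[/eqP]] := unitary_perm_disc ab uc.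
  by rewrite D in Dw; rewrite (antifixed_square_eq0 L2 uc cw cD Dw) eqxx in w0.
have r0 : r != 0 by rewrite -sqrf_eq0 r2 oppr_eq0 char_neq3.
have L6 : 6%:R != 0 :> L by rewrite -[6%N]/(2 * 3)%N natrM mulf_neq0 // char_neq3.
by rewrite D sqrf_eq0 !mulf_eq0 (negPf L6) (negPf r0) (negPf c21).
Qed.

Lemma disc_mul_disc0 c :
    disc1 a b ^+ 2 + 2%:R * disc0 a b ^+ 2 = disc0 a b * disc2 a b ->
  disc0 a b * disc a b c
    = ((disc0 a b * c + disc1 a b) * c + disc0 a b) ^+ 2.
Proof.
rewrite /disc /quartic; move: (disc0 a b) (disc1 a b) (disc2 a b) => d0 d1 d2 E.
transitivity (d0 ^+ 2 + 2%:R * d0 * d1 * c + d0 * d2 * c ^+ 2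
   + 2%:R * d0 * d1 * c ^+ 3 + d0 ^+ 2 * c ^+ 4); first by ring.
by rewrite -E; ring.
Qed.

Lemma conj_palindrome d0 d1 c : conj d0 = d0 -> conj d1 = d1 -> mu c ->
  conj (((d0 * c + d1) * c + d0) / c) = ((d0 * c + d1) * c + d0) / c.
Proof.
move=> cd0 cd1 uc; have c0 := unitary_neq0 uc.
rewrite rmorphM fmorphV !(rmorphD, rmorphM) cd0 cd1 conj_unitary //.
by field; rewrite ?c0 ?oner_eq0.
Qed.

(** When disc0 * disc is a square, disc0 is in the square class of disc / c^2. *)
Lemma disc0_square : disc0 a b != 0 -> unitary_perm a b ->
  disc1 a b ^+ 2 + 2%:R * disc0 a b ^+ 2 = disc0 a b * disc2 a b ->
  fixed_square (disc0 a b).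
Proof.
move=> d0n0 ab /disc_mul_disc0 d0D; have [cd0 cd1 _] := conj_disc_coef.
have [||c uc] := @unitary_nonroot (Poly [:: disc0 a b; disc1 a b; disc0 a b]).
- apply: contra_neq d0n0 => /(congr1 (fun p : {poly L} => p`_0)).
  by rewrite coef_Poly coef0.
- exact: size_Poly.
have c0 := unitary_neq0 uc.
rewrite rootE horner_Poly /= mul0r add0r => e0.
have [[w [w0 ww D]]|[D _]] := unitary_perm_disc ab uc; last first.
  by move: (d0D c); rewrite D mulr0 => /esym/eqP; rewrite sqrf_eq0 (negPf e0).
exists (((disc0 a b * c + disc1 a b) * c + disc0 a b) / c / w); split.
- by rewrite !mulf_neq0 // invr_eq0.
- by rewrite rmorphM fmorphV ww conj_palindrome.
by rewrite -mulrA -invfM expr_div_n -d0D D mulfK // expf_neq0 // mulf_neq0.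
Qed.

(** The constant k of quartic_square_values is disc0 or - disc0. If disc0 = 0 the
    quartic is a multiple of c^2; if k = disc0 != 0 it is a multiple of (c^2 - 1)^2,
    so it vanishes at 1 and -1; if k = - disc0 it is a multiple of the square of
    another palindromic quadratic. *)
Lemma unitary_perm_coefs : unitary_perm a b -> perm_coefs.
Proof.
move=> ab; have [h0 ginj] := ab.
have u1 : mu 1 by rewrite /unitary rmorph1 mulr1.
have uN1 : mu (- 1) by rewrite /unitary rmorphN rmorph1 mulrNN mulr1.
have h1 := h0 _ u1; have hN1 := h0 _ uN1.
have [cd0 cd1 cd2] := conj_disc_coef.
have [z zP] := unitary_prim_root.
have [] := @quartic_square_values L q n qE pq n_gt0 z zP
  (disc0 a b) (disc1 a b) (disc2 a b).
- by rewrite -conjE.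
- by rewrite -conjE.
- by rewrite -conjE.
- move=> c /eqP; rewrite -unitaryE => uc.
  have [[w [w0 ww D]]|] := unitary_perm_disc ab uc; last by right.
  by left; exists w; rewrite -conjE.
move=> k [kd0 kd1 kd2].
have [d00|d0n0] := eqVneq (disc0 a b) 0.
  have k0 : k = 0 by apply/eqP; rewrite -sqrf_eq0 kd0 d00 expr0n.
  have d10 : disc1 a b = 0.
    by apply/eqP; rewrite -sqrf_eq0 -[_ ^+ 2]subr0; move: kd2;
      rewrite k0 d00 mulr0 mul0r => ->.
  have [a0|a0] := eqVneq a 0.
    have b0 : b = 0.
      have : 2%:R * b ^+ 3 = 0 by rewrite -d10 /disc1 a0; ring.
      by move/eqP; rewrite mulf_eq0 (negPf L2) expf_eq0 => /eqP.
    by constructor 4; split=> //; apply: unitary_perm_cube.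
  have b2 : b ^+ 2 = 4%:R * a.
    by apply/eqP; move/eqP: d00; rewrite mulf_eq0 sqrf_eq0 (negPf a0) subr_eq0.
  have a1 : a = 1.
    have b0 : b != 0.
      apply: contra_neq a0 => b0; apply: (mulfI L2); apply: (mulfI L2).
      by rewrite mulr0 mulr0 -[RHS](expr0n L 2) -b0 b2; ring.
    have /eqP : - (b * a) * (a - 1) ^+ 2 = 0.
      transitivity (b * (- a ^+ 3 - a * (4%:R * a) + 6%:R * a ^+ 2
        + 2%:R * (4%:R * a) - 9%:R * a)); first by ring.
      by rewrite -b2 -d10.
    rewrite mulf_eq0 oppr_eq0 mulf_eq0 (negPf b0) (negPf a0) sqrf_eq0 subr_eq0.
    by move/eqP.
  (* Here b = 2 or b = - 2, and hpol is (u + 1)^2 or (u - 1)^2. *)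
  have : (hpol a b 1) * (hpol a b (- 1)) = 0.
    by rewrite /hpol -[RHS](subrr (4%:R * a)) -{2}b2 a1; ring.
  by move/eqP; rewrite mulf_eq0 (negPf h1) (negPf hN1).
have : k ^+ 2 == disc0 a b ^+ 2 by rewrite kd0.
rewrite eqf_sqr => /orP[] /eqP kE.
  have d10 : disc1 a b = 0.
    apply: (mulfI d0n0); apply: (mulfI L2).
    by rewrite !mulr0 -[RHS]kd1 kE; ring.
  have d2E : disc2 a b = - 2%:R * disc0 a b.
    apply: (mulfI d0n0); rewrite -kd2 d10 kE; ring.
  have D1 : (b - a + 3%:R) ^+ 3 * (b - a - 1) = 0.
    transitivity (disc a b 1); last by rewrite /disc /quartic d10 d2E; ring.
    by rewrite /disc /quartic /disc0 /disc1 /disc2; ring.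
  have DN1 : (- b - a + 3%:R) ^+ 3 * (- b - a - 1) = 0.
    transitivity (disc a b (- 1)); last by rewrite /disc /quartic d10 d2E; ring.
    by rewrite /disc /quartic /disc0 /disc1 /disc2; ring.
  have ba : b - a + 3%:R = 0.
    apply/eqP; move/eqP: D1; rewrite mulf_eq0 expf_eq0 /= => /orP[//|].
    have -> : b - a - 1 = - hpol a b (- 1) by rewrite /hpol; ring.
    by rewrite oppr_eq0 (negPf hN1).
  have ba' : - b - a + 3%:R = 0.
    apply/eqP; move/eqP: DN1; rewrite mulf_eq0 expf_eq0 /= => /orP[//|].
    have -> : - b - a - 1 = - hpol a b 1 by rewrite /hpol; ring.
    by rewrite oppr_eq0 (negPf h1).
  have b0 : b = 0.
    by apply: (mulfI L2); rewrite mulr0 -[RHS](subrr 0) -{1}ba -ba'; ring.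
  have a3 : a = 3%:R by rewrite -[RHS](subr0) -ba b0; ring.
  by constructor 3; split=> //; apply: unitary_perm_three.
have E : disc1 a b ^+ 2 + 2%:R * disc0 a b ^+ 2 = disc0 a b * disc2 a b.
  by rewrite -kd2 kE; ring.
have [v [v0 cv vE]] := disc0_square d0n0 ab E.
move/esym/eqP: disc_coef_discr.
rewrite E subrr mulf_eq0 mulf_eq0 oppr_eq0 expf_eq0 !subr_eq0 /= orbAC -orbA.
have L4 : 4%:R != 0 :> L by rewrite -[4%N]/(2 * 2)%N natrM mulf_neq0.
have a0 : a != 0.
  by apply: contra_neq d0n0 => a0; rewrite /disc0 a0 expr0n mul0r.
have ba : b ^+ 2 - 4%:R * a = (v / a) ^+ 2.
  by rewrite expr_div_n -vE /disc0; field; rewrite ?a0 ?oner_eq0.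
have sq : fixed_square (b ^+ 2 - 4%:R * a).
  exists (v / a); split=> //; first by rewrite mulf_neq0 ?invr_eq0.
  by rewrite rmorphM fmorphV cv conja.
rewrite (negPf L4) /= => /orP[] /eqP E'.
  constructor 1; split=> //.
  by move: sq; rewrite E'; congr (fixed_square _); ring.
by constructor 2; split=> //; move: sq; rewrite E' mulr1.
Qed.

Lemma gmap_inj_disc :
    (forall u, mu u -> hpol a b u != 0) ->
    (forall c, mu c -> exists w, [/\ conj w = w, disc a b c = (c * w) ^+ 2 &
       w = 0 -> (b * c - a) ^+ 2 = 3%:R * c * (a * c - b)]) ->
  unitary_perm a b.
Proof.
move=> h0 sq; split=> // u v uu uv guv.
have uc := gmap_unitary uu (h0 u uu).
have [w [cw Dw w0]] := sq _ uc.
apply: (unitary_fibre_inj L2 uc cw Dw w0) => //; apply/eqP.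
  by rewrite gmap_fibre ?h0.
by rewrite gmap_fibre ?h0 // guv.
Qed.

(** The conjugate of a common zero u gives a u^2 + b u + 1 = 0 as well. *)
Lemma hpol_root u : mu u -> hpol a b u = 0 -> (a - 1) * (u ^+ 2 - 1) = 0.
Proof.
move=> uu hu; have u0 := unitary_neq0 uu.
have : conj (hpol a b u) * u ^+ 2 = 0 by rewrite hu rmorph0 mul0r.
rewrite conj_hpol // mulfVK ?expf_neq0 // => hu'.
by rewrite -[RHS](subrr 0) -{1}hu' -hu /hpol; ring.
Qed.

Lemma hpol_neq0 : a != 1 -> (a + 1) ^+ 2 != b ^+ 2 ->
  forall u, mu u -> hpol a b u != 0.
Proof.
move=> a1 ab u uu; apply: contra_neq ab => hu.
have /eqP := hpol_root uu hu.
rewrite mulf_eq0 !subr_eq0 (negPf a1) sqrf_eq1 /= => /orP[] /eqP uE; move: hu.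
  rewrite uE /hpol => E; have -> : b = - (a + 1) by rewrite -[LHS]subr0 -E; ring.
  by rewrite sqrrN.
by rewrite uE /hpol => E; congr (_ ^+ 2); rewrite -[RHS]addr0 -E; ring.
Qed.

Lemma coefs_unitary_perm : perm_coefs -> unitary_perm a b.
Proof.
have [cd0 cd1 _] := conj_disc_coef.
case=> [[[v [v0 cv vE]] b2]|[a1 [v [v0 cv vE]]]|[a3 b0 q3]|[a0 b0 q3]].
- have /andP[a0 a1] : (a != 0) && (a - 1 != 0).
    by rewrite -negb_or -mulf_eq0 vE sqrf_eq0.
  have d0E : disc0 a b = (a * v) ^+ 2.
    by rewrite exprMn -vE /disc0 b2; ring.
  have av0 : a * v != 0 by rewrite mulf_neq0.
  apply: gmap_inj_disc.
    apply: hpol_neq0; first by rewrite -subr_eq0.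
    rewrite b2 -subr_eq0; apply: contra a1 => /eqP E.
    by rewrite -oppr_eq0 -E; apply/eqP; ring.
  move=> c uc; have c0 := unitary_neq0 uc.
  (* w vanishes exactly when the fibre over c is a perfect cube. *)
  have wE : (disc0 a b * c + disc1 a b) * c + disc0 a b =
      a * (a - 1) * ((b * c - a) ^+ 2 - 3%:R * c * (a * c - b)).
    (* The second summand is the multiple of b^2 - (a^2 + 3 a) separating both sides. *)
    transitivity (a * (a - 1) * (a ^+ 2 * c ^+ 2 - b * (2%:R * a - 3%:R) * c + a ^+ 2)
      + (b ^+ 2 - (a ^+ 2 + 3%:R * a)) * (a ^+ 2 * (c ^+ 2 + 1) - (a - 2%:R) * b * c)).
      by rewrite /disc0 /disc1; ring.
    rewrite b2 subrr mul0r addr0.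
    transitivity (a * (a - 1) * ((b ^+ 2 - 3%:R * a) * c ^+ 2
      - b * (2%:R * a - 3%:R) * c + a ^+ 2)); last by ring.
    by rewrite b2; ring.
  exists (((disc0 a b * c + disc1 a b) * c + disc0 a b) / c / (a * v)); split.
  - by rewrite rmorphM fmorphV [conj (a * v)]rmorphM conja cv conj_palindrome.
  - have E : disc1 a b ^+ 2 + 2%:R * disc0 a b ^+ 2 = disc0 a b * disc2 a b.
      by apply/eqP; rewrite -subr_eq0 disc_coef_discr b2 subrr expr0n mulr0.
    have := disc_mul_disc0 c E; rewrite {1}d0E.
    move: ((_ * c + _) * c + _) => p /(canRL (mulKf (expf_neq0 2 av0)))->.
    by field; rewrite ?a0 ?v0 ?c0.
  move/eqP; rewrite wE !mulf_eq0 !invr_eq0 !mulf_eq0.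
  by rewrite (negPf a0) (negPf a1) (negPf c0) (negPf v0) /= !orbF subr_eq0 => /eqP.
- have h0 u : mu u -> hpol a b u != 0.
    move=> uu; apply: contra_neq v0 => hu; have u0 := unitary_neq0 uu.
    apply: (antifixed_square_eq0 L2 (unitary1 conj) cv (d := u - u^-1)).
      by rewrite rmorphB fmorphV conj_unitary // invrK expr1n divr1 opprB.
    have bE : b = - (u + u^-1).
      transitivity ((hpol a b u - u ^+ 2 - 1) / u); last first.
        by rewrite hu; field; rewrite ?u0 ?oner_eq0.
      by rewrite /hpol a1; field; rewrite ?u0 ?oner_eq0.
    by rewrite mul1r -vE bE; field; rewrite ?u0 ?oner_eq0.
  split=> // u w uu uw.
  have gV x : mu x -> gmap a b x = x^-1.
    move=> ux; have x0 := unitary_neq0 ux; have hx := h0 x ux.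
    have -> : gmap a b x = x * (hpol a b x / x ^+ 2) / hpol a b x.
      by rewrite /gmap conj_hpol // /hpol a1 mul1r addrAC.
    by field; rewrite ?x0 ?hx.
  by rewrite !gV // => /invr_inj.
- have L30 : 3%:R != 0 :> L by apply: char_neq3; rewrite q3.
  have L4 : 4%:R != 0 :> L by rewrite -[4%N]/(2 * 2)%N natrM mulf_neq0.
  apply: gmap_inj_disc.
    apply: hpol_neq0.
      by rewrite a3 -subr_eq0; apply: contra_neq L2 => <-; ring.
    rewrite a3 b0 expr0n; apply: contra L4.
    by rewrite sqrf_eq0 => /eqP <-; apply/eqP; ring.
  move=> c uc; have c0 := unitary_neq0 uc.
  have [|r [r2]] := sqrt_m3; first by rewrite q3.
  rewrite q3 /= => cr; exists (6%:R * r * (c - c^-1)); split.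
  - rewrite !rmorphM rmorphB fmorphV rmorph_nat cr conj_unitary // invrK.
    by ring.
  - have -> : (c * (6%:R * r * (c - c^-1))) ^+ 2 = 36%:R * r ^+ 2 * (c ^+ 2 - 1) ^+ 2.
      by field; rewrite ?c0 ?oner_eq0.
    by rewrite r2 /disc /quartic /disc0 /disc1 /disc2 a3 b0; ring.
  have r0 : r != 0 by rewrite -sqrf_eq0 r2 oppr_eq0.
  have L6 : 6%:R != 0 :> L by rewrite -[6%N]/(2 * 3)%N natrM mulf_neq0.
  move/eqP; rewrite !mulf_eq0 (negPf L6) (negPf r0) subr_eq0 /= => /eqP cV.
  have c2 : c ^+ 2 = 1 by rewrite expr2 {2}cV mulfV.
  by rewrite a3 b0; transitivity (9%:R * c ^+ 2); [rewrite c2; ring | ring].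
apply: gmap_inj_disc.
  apply: hpol_neq0; first by rewrite a0 eq_sym oner_eq0.
  by rewrite a0 b0 add0r expr1n expr0n /= oner_eq0.
have discE c : disc a b c = - 3%:R * (3%:R * c) ^+ 2.
  by rewrite /disc /quartic /disc0 /disc1 /disc2 a0 b0; ring.
move=> c uc; have [q30|q31] : (q %% 3 = 0)%N \/ (q %% 3 = 1)%N by lia.
  exists 0; split; first by rewrite rmorph0.
    by rewrite discE (char_eq3 q30) oppr0 mul0r mulr0 expr0n.
  by move=> _; rewrite a0 b0; ring.
have [|r [r2]] := sqrt_m3; first by rewrite q31.
rewrite q31 /= => cr; exists (3%:R * r); split.
- by rewrite rmorphM rmorph_nat cr.
- by rewrite discE -r2; ring.
by move=> _; rewrite a0 b0; ring.
Qed.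
End Coef.
End Core.

(** * From the norm-one group to the field *)

(** As f (t x) = t * f x for t^(q - 1) = 1, the map f permutes L exactly when it has
    no zero but 0 and the map that it induces on the (q - 1)-th powers, that is on
    the elements of norm one, is injective. *)
Lemma unitary_perm_bijective (L : finFieldType) (q n : nat) (conj : {rmorphism L -> L})
    (qE : q = n.*2.+1) (n_gt0 : (0 < n)%N) (card_L : #|L| = (q ^ 2)%N)
    (conjE : forall x, conj x = x ^+ q) (a b : L)
    (conja : conj a = a) (conjb : conj b = b) :
  bijective (fun x : L => a * x + b * x ^+ q + x ^+ (2 * q - 1)) <->
  unitary_perm conj a b.
Proof.
have q1 : q = q.-1.+1 by rewrite qE.
have fE x : a * x + b * x ^+ q + x ^+ (2 * q - 1) = x * hpol a b (x ^+ q.-1).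
  have -> : (2 * q - 1 = q.-1 + q.-1 + 1)%N by rewrite qE; lia.
  by rewrite {1}q1 exprS !exprD expr1 /hpol expr2; ring.
set f := fun x : L => _.
have fx x : f x = x * hpol a b (x ^+ q.-1) by exact: fE.
have uX x : x != 0 -> unitary conj (x ^+ q.-1).
  move=> x0; rewrite (unitaryE conjE) -exprM mulnC (card_L_unit qE n_gt0 card_L).
  apply/eqP/(mulfI x0); rewrite -exprS prednK ?expf_card ?mulr1 //.
  by rewrite card_L qE expn_gt0.
have fX x : x != 0 -> hpol a b (x ^+ q.-1) != 0 ->
    f x ^+ q.-1 = gmap conj a b (x ^+ q.-1).
  move=> x0 h0; rewrite fx exprMn /gmap conjE -mulrA; congr (_ * _).
  have -> (h : L) : h ^+ q = h ^+ q.-1 * h by rewrite {1}q1 exprSr.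
  by rewrite mulfK.
split=> [/bij_inj finj|[h0 ginj]].
  have h0 u : unitary conj u -> hpol a b u != 0.
    case/(unitary_Hilbert90 qE n_gt0 card_L conjE) => x x0 <-; apply: contra_neq x0 => hx.
    by apply: finj; rewrite !fx hx mulr0 mul0r.
  split=> // u v uu uv.
  have [x x0 xu] := unitary_Hilbert90 qE n_gt0 card_L conjE uu.
  have [y y0 yv] := unitary_Hilbert90 qE n_gt0 card_L conjE uv.
  rewrite -xu -yv -!fX ?xu ?yv ?h0 // => fxy.
  have fy0 : f y != 0 by rewrite fx mulf_neq0 // yv h0.
  have fx0 : f x != 0 by rewrite fx mulf_neq0 // xu h0.
  pose t := f x / f y.
  have t0 : t != 0 by rewrite mulf_neq0 ?invr_eq0.
  have tq : t ^+ q.-1 = 1 by rewrite expr_div_n fxy divff ?expf_neq0.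
  rewrite -xu -yv; have -> : x = t * y; last by rewrite exprMn tq mul1r.
  apply: finj; rewrite [RHS]fx exprMn tq mul1r -mulrA -fx.
  by rewrite /t divfK.
apply: injF_bij => x y fxy.
have f00 z : f z = 0 -> z = 0.
  move=> fz; apply: contraTeq isT => z0.
  by move/eqP: fz; rewrite fx mulf_eq0 (negPf z0) (negPf (h0 _ (uX z z0))).
have [x0|x0] := eqVneq x 0.
  by rewrite x0; apply/esym/f00; rewrite -fxy x0 fx mul0r.
have [y0|y0] := eqVneq y 0.
  by rewrite y0; apply/f00; rewrite fxy y0 fx mul0r.
have E : x ^+ q.-1 = y ^+ q.-1.
  by apply: ginj; rewrite ?uX // -!fX ?h0 ?uX // fxy.
by move: fxy; rewrite !fx E => /(mulIf (h0 _ (uX y y0))).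
Qed.

(** The image of F already exhausts the q roots of X^q - X. *)
Lemma fixed_image (q : nat) (F L : finFieldType) (iota : {rmorphism F -> L}) (w : L) :
  (1 < q)%N -> #|F| = q -> w ^+ q = w -> exists w0, iota w0 = w.
Proof.
move=> q1 card_F wq; suff /codomP[w0 ->] : w \in codom iota by exists w0.
apply: contraT => wF.
have := @max_poly_roots L ('X^q - 'X) (w :: codom iota).
rewrite -size_poly_eq0 size_polyDl ?size_polyXn ?size_polyN ?size_polyX //.
rewrite /= size_codom card_F ltnn => -> //.
  rewrite rootE !hornerE wq subrr eqxx /=; apply/allP => _ /codomP[x ->].
  by rewrite rootE !hornerE -rmorphXn -card_F expf_card subrr.
by rewrite wF map_inj_uniq ?enum_uniq //; apply: fmorph_inj.
Qed.

Theorem theoremA (q : nat) (F L : finFieldType) (iota : {rmorphism F -> L})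
    (q_odd : odd q) (card_F : #|F| = q) (card_L : #|L| = (q ^ 2)%N)
    (a b : F) :
  permutation_poly (map_poly iota (trinomial q a b)) <->
  [\/ nonzero_square (a * (a - 1)) /\ b ^+ 2 = a ^+ 2 + 3%:R * a,
      a = 1 /\ nonzero_square (b ^+ 2 - 4%:R),
      [/\ a = 3%:R, b = 0 & q = 5 %[mod 6]]
    | [/\ a = 0, b = 0 & q = 1 %[mod 6] \/ q = 3 %[mod 6]]].
Proof.
have [conj conjE] := Frobenius_rmorphism (pnat_sqrt_card card_L).
have q_gt1 : (1 < q)%N by rewrite -card_F finNzRing_gt1.
have qE : q = q./2.*2.+1 by rewrite -[LHS]odd_double_half q_odd.
have n_gt0 : (0 < q./2)%N by move: q_gt1; rewrite {1}qE; case: (q./2).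
have conjF x : conj (iota x) = iota x.
  by rewrite conjE -rmorphXn -{1}card_F expf_card.
have perm_f : permutation_poly (map_poly iota (trinomial q a b)) <->
    unitary_perm conj (iota a) (iota b).
  rewrite -(unitary_perm_bijective qE n_gt0 card_L conjE (conjF a) (conjF b)).
  have fE x : (map_poly iota (trinomial q a b)).[x]
      = iota a * x + iota b * x ^+ q + x ^+ (2 * q - 1).
    by rewrite /trinomial !rmorphD /= !map_polyZ /= !map_polyXn map_polyX !hornerE.
  by split=> f_bij; apply: (eq_bij f_bij) => x; rewrite /= fE.
have sqF (d : F) : fixed_square conj (iota d) <-> nonzero_square d.
  split=> [[v [v0 cv dE]]|[v [v0 ->]]]; last first.
    by exists (iota v); rewrite fmorph_eq0 conjF rmorphXn.
  have [w wv] : exists w, iota w = v.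
    by apply: (@fixed_image q F L iota v) => //; rewrite -conjE.
  exists w; split; first by rewrite -(fmorph_eq0 iota) wv.
  by apply: (fmorph_inj iota); rewrite rmorphXn /= wv.
have eqF (x y : F) : iota x = iota y <-> x = y.
  by split=> [/fmorph_inj|->].
have sq1 : fixed_square conj (iota a * (iota a - 1)) <-> nonzero_square (a * (a - 1)).
  by rewrite -sqF rmorphM rmorphB rmorph1.
have sq4 : fixed_square conj (iota b ^+ 2 - 4%:R) <-> nonzero_square (b ^+ 2 - 4%:R).
  by rewrite -sqF rmorphB rmorphXn rmorph_nat.
have b2 : iota b ^+ 2 = iota a ^+ 2 + 3%:R * iota a <-> b ^+ 2 = a ^+ 2 + 3%:R * a.
  by rewrite -eqF rmorphD rmorphM !rmorphXn rmorph_nat.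
have a1 : iota a = 1 <-> a = 1 by rewrite -eqF rmorph1.
have a3 : iota a = 3%:R <-> a = 3%:R by rewrite -eqF rmorph_nat.
have a0 : iota a = 0 <-> a = 0 by rewrite -eqF rmorph0.
have b0 : iota b = 0 <-> b = 0 by rewrite -eqF rmorph0.
have q5 : (q %% 3 = 2)%N <-> q = 5 %[mod 6] by lia.
have q13 : (q %% 3 <> 2)%N <-> q = 1 %[mod 6] \/ q = 3 %[mod 6] by lia.
rewrite perm_f; split=> [/(unitary_perm_coefs qE n_gt0 card_L conjE (conjF a) (conjF b))|good].
  case=> [[/sq1 ? /b2 ?]|[/a1 ? /sq4 ?]|[/a3 ? /b0 ? /q5 ?]|[/a0 ? /b0 ? /q13 ?]];
  by [constructor 1 | constructor 2 | constructor 3 | constructor 4].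
apply: (coefs_unitary_perm qE n_gt0 card_L conjE (conjF a) (conjF b)).
case: good=> [[/sq1 ? /b2 ?]|[/a1 ? /sq4 ?]|[/a3 ? /b0 ? /q5 ?]|[/a0 ? /b0 ? /q13 ?]];
by [constructor 1 | constructor 2 | constructor 3 | constructor 4].
Qed.
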